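(* For the Gaussian location model, suppose the power constraint is $P$, the channel noise variance is $\sigma_0^2$ and there are $s=d$ channel uses. Then the minimax (worst-case over $\theta\in\Theta$) estimation error of the $\epsilon$-robust over-the-air estimation scheme is $$R_{robust}=\frac{d\sigma^2}{n}\left[1+\frac{d}{2n\epsilon}\left(1+\frac{B^2}{\sigma^2}\right)\right].$$
   Context: Gaussian location model: $\Theta=\{\theta\in\mathbb R^d:\|\theta\|_2\le B\sqrt d\}$ and $p_\theta=\mathcal N(\theta,\sigma^2I_d)$, for known $\sigma,B>0$; the $n$ users hold $U_1,\dots,U_n$, i.i.d. with law $p_\theta$. $\epsilon$-robust over-the-air estimation scheme: let $\sigma_{pri}^2=\max\{\frac{sP-2\epsilon\sigma_0^2}{2\epsilon n+s},0\}$ with $s=d$. The scheme takes the minimax optimal (deterministic, invertible) over-the-air scheme for power constraint $P'=P-\sigma_{pri}^2$ and channel noise variance $\sigma_0^2+n\sigma_{pri}^2$, and adds independent local noise $\mathcal N(0,\sigma_{pri}^2I_d)$ at each user. Concretely, user $i$ sends $X_i=\sqrt{\frac{P'}{B^2+\sigma^2}}\,U_i+Z_{pri,i}$, where $Z_{pri,i}\sim\mathcal N(0,\sigma_{pri}^2I_d)$ are independent of each other and of the data; the processor receives $Y=\sum_{i=1}^nX_i+Z$, with channel noise $Z\sim\mathcal N(0,\sigma_0^2I_d)$ independent of everything else, and uses $\hat\theta(Y)=\frac1n\sqrt{\frac{B^2+\sigma^2}{P'}}\,Y$. The worst-case error is $R_{robust}=\sup_{\theta\in\Theta}\mathbb 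E_\theta\|\hat\theta(Y)-\theta\|_2^2$.
   Formalization: The formal theorem adds the assumption 2εσ_0² ≤ dP; when 2εσ_0² > dP the scheme has σ_pri² = 0 and its worst-case error is (dσ²/n)[1 + (σ_0²/(nP))(1 + B²/σ²)], strictly larger than the stated formula. *)

(* Defs.v *)
From HB Require Import structures.
From mathcomp Require Import all_boot all_order all_algebra.
From mathcomp Require Import all_classical all_reals all_analysis.
Set Implicit Arguments.
Unset Strict Implicit.
Unset Printing Implicit Defensive.
Import Order.TTheory GRing.Theory Num.Theory.
Import numFieldNormedType.Exports.

Local Open Scope classical_set_scope.
Local Open Scope ring_scope.

(* Random vectors take values in d.-tuple R, which carries the product
   sigma-algebra in the library; vector arithmetic takes place in 'rV[R]_d. *)
Definition vec (R : realType) (d : nat) (x : d.-tuple R) : 'rV[R]_d :=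
  \row_k tnth x k.

(* The norm provided by the library on 'rV[R]_d is the sup norm, hence an
   explicit Euclidean norm. *)
Definition sqnorm2 (R : realType) (d : nat) (x : 'rV[R]_d) : R :=
  \sum_k x 0 k ^+ 2.

Definition norm2 (R : realType) (d : nat) (x : 'rV[R]_d) : R :=
  Num.sqrt (sqnorm2 x).

(* N(m, v) on the real line, parameterized by the variance v >= 0. The case
   v = 0 is separate because normal_prob m 0 is not the Dirac mass at m. *)
Definition gaussian (R : realType) (m v : R) (A : set R) : \bar R :=
  if v == 0 then \d_m A else normal_prob m (Num.sqrt v) A.

(* The law of V under Q is N(m, v I_d), the product of the N(m_k, v); it is
   determined by its values on measurable rectangles. *)
Definition has_gaussian_law (R : realType) (d : nat) (disp : measure_display)
    (Omega : measurableType disp) (Q : probability Omega R)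
    (V : {RV Q >-> d.-tuple R}) (m : 'rV[R]_d) (v : R) : Prop :=
  forall A : 'I_d -> set R, (forall k, measurable (A k)) ->
    distribution Q V [set x | forall k, A k (tnth x k)] =
    (\prod_(k < d) gaussian (m ord0 k) v (A k))%E.

Definition mutually_independent (R : realType)
    (disp disp' : measure_display) (Omega : measurableType disp)
    (T : measurableType disp') (Q : probability Omega R) (I : finType)
    (V : I -> {RV Q >-> T}) : Prop :=
  forall (J : {set I}) (A : I -> set T), (forall i, measurable (A i)) ->
    Q (\bigcap_(i in [set` J]) (V i @^-1` A i)) =
    (\prod_(i in J) Q (V i @^-1` A i))%E.

Definition all_sources (n : nat) (S : Type) (U Zpri : 'I_n -> S) (Z : S)
    (j : option ('I_n + 'I_n)) : S :=
  match j with
  | Some (inl i) => U i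
  | Some (inr i) => Zpri i
  | None => Z
  end.

Definition Theta (R : realType) (d : nat) (B : R) : set 'rV[R]_d :=
  [set theta | norm2 theta <= B * Num.sqrt d%:R].

(* sigma_pri^2, as a function of the number s of channel uses. *)
Definition sigma_pri2 (R : realType) (n s : nat) (P sigma0 eps : R) : R :=
  Num.max ((s%:R * P - 2 * eps * sigma0 ^+ 2) / (2 * eps * n%:R + s%:R)) 0.

Definition power_left (R : realType) (n s : nat) (P sigma0 eps : R) : R :=
  P - sigma_pri2 n s P sigma0 eps.

(* Pr theta is the joint law, for the parameter theta, of the data U, the local
   noises Zpri and the channel noise Z. *)
Definition robust_model (R : realType) (n d : nat)
    (sigma B P sigma0 eps : R) (disp : measure_display)
    (Omega : measurableType disp) (Pr : 'rV[R]_d -> probability Omega R)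
    (U Zpri : 'I_n -> {mfun Omega >-> d.-tuple R})
    (Z : {mfun Omega >-> d.-tuple R}) : Prop :=
  forall theta : 'rV[R]_d, Theta B theta ->
    [/\ forall i, has_gaussian_law (Q := Pr theta) (U i) theta (sigma ^+ 2),
        forall i, has_gaussian_law (Q := Pr theta) (Zpri i) 0
                    (sigma_pri2 n d P sigma0 eps),
        has_gaussian_law (Q := Pr theta) Z 0 (sigma0 ^+ 2) &
        mutually_independent (Q := Pr theta) (all_sources U Zpri Z)].

Section scheme.
Context (R : realType) (n d : nat) (sigma B P sigma0 eps : R).
Context (disp : measure_display) (Omega : measurableType disp).
Context (Pr : 'rV[R]_d -> probability Omega R).
Context (U Zpri : 'I_n -> {mfun Omega >-> d.-tuple R}).
Context (Z : {mfun Omega >-> d.-tuple R}).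

Let P' : R := power_left n d P sigma0 eps.

Definition sent (i : 'I_n) (w : Omega) : 'rV[R]_d :=
  Num.sqrt (P' / (B ^+ 2 + sigma ^+ 2)) *: vec (U i w) + vec (Zpri i w).

Definition received (w : Omega) : 'rV[R]_d :=
  \sum_(i < n) sent i w + vec (Z w).

Definition estimator (y : 'rV[R]_d) : 'rV[R]_d :=
  (n%:R^-1 * Num.sqrt ((B ^+ 2 + sigma ^+ 2) / P')) *: y.

Definition R_robust : \bar R :=
  ereal_sup
    [set 'E_(Pr theta)[fun w => sqnorm2 (estimator (received w) - theta)]%E
      | theta in Theta B].

End scheme.

(* Main.v *)
(* Coordinate by coordinate, the estimation error is a linear combination of the
   2n + 1 centered sources: the data with weight 1/n, the local and channel
   noises with weight g = (1/n) sqrt((B^2 + sigma^2) / P').  Independent centered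
   sources are uncorrelated, so the mean square error of a coordinate is
   sigma^2 / n + g^2 (n sigma_pri^2 + sigma_0^2), whatever theta is.  The choice of
   sigma_pri^2 makes (n sigma_pri^2 + sigma_0^2) / P' equal to d / (2 eps). *)
Require Import Defs.
From HB Require Import structures.
From mathcomp Require Import all_boot all_order all_algebra.
From mathcomp Require Import all_classical all_reals all_analysis.
From mathcomp Require Import measurable_realfun ring lra.
Import Order.TTheory GRing.Theory Num.Theory.
Import numFieldNormedType.Exports.

Local Open Scope classical_set_scope.
Local Open Scope ring_scope.

(** * Invariance of Lebesgue measure under the reflections [x |-> c - x] *)

Section lebesgue_reflection.
Context {R : realType}.
Let mu := @lebesgue_measure R.
Local Open Scope ereal_scope.

Lemma measurable_reflect (c : R) :
  measurable_fun setT (fun x : measurableTypeR R => c - x : measurableTypeR R)%R.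
Proof. exact: measurable_funB. Qed.

(** A measure that agrees with Lebesgue measure on the intervals []a, b]] is Lebesgue measure; the
    preimage of such an interval is [[c - b, c - a[], of the same length. *)
Lemma lebesgue_measure_reflect (c : R) (A : set R) : measurable A ->
  pushforward mu (fun x : measurableTypeR R => c - x : measurableTypeR R)%R A =
  mu A.
Proof.
move=> mA; apply/esym.
pose phi := HB.pack_for {mfun measurableTypeR R >-> measurableTypeR R}
  (fun x : measurableTypeR R => c - x : measurableTypeR R)%R
  (isMeasurableFun.Build _ _ _ _ _ (measurable_reflect c)).
have -> : pushforward mu (fun x : measurableTypeR R => c - x : measurableTypeR R)%R
  = pushforward mu phi by [].
apply: lebesgue_measure_unique => //= _ [[a b]] _ <-.
rewrite /pushforward/=.
have -> : phi @^-1` `]a, b]%classic = `[c - b, c - a[%classic%R.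
  by apply/seteqP; split => x /=; rewrite !in_itv/= => /andP[? ?]; apply/andP; split; lra.
rewrite !lebesgue_measure_itv/= !lte_fin ltrD2l ltrN2.
by case: ifP => // _; rewrite -!EFinB; congr EFin; ring.
Qed.

Lemma ge0_integral_reflect (c : R) (f : R -> \bar R) :
  measurable_fun setT f -> (forall x, 0 <= f x) ->
  \int[mu]_x f (c - x)%R = \int[mu]_x f x.
Proof.
move=> mf f0.
have := @ge0_integral_pushforward _ _ _ _ R _ (measurable_reflect c) mu setT f
  measurableT mf (fun y _ => f0 y).
rewrite preimage_setT => <-.
apply: eq_measure_integral => [|? A mA _]; first exact: measurable_reflect.
exact: lebesgue_measure_reflect.
Qed.

End lebesgue_reflection.

(** * Integration against the normal density and its second moment *)

Section normal_moments.
Context {R : realType}.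
Let mu := @lebesgue_measure R.
Local Open Scope ereal_scope.

Lemma normal_pdf_reflect (c m s x : R) : s != 0%R ->
  normal_pdf m s (c - x) = normal_pdf (c - m) s x.
Proof.
move=> s0; rewrite !normal_pdfE// /normal_fun; congr (_ * expR _)%R.
by congr (- _ / _)%R; ring.
Qed.

(** The Radon-Nikodym derivative of [normal_prob m s] and [normal_pdf m s] have the same integral
    over every measurable set, so they agree almost everywhere and may be exchanged under the
    integral. *)
Lemma ge0_integral_normal_prob (m s : R) (f : R -> \bar R) :
  measurable_fun setT f -> (forall x, 0 <= f x) ->
  \int[normal_prob m s]_x f x = \int[mu]_x (f x * (normal_pdf m s x)%:E).
Proof.
move=> mf f0.
rewrite -(Radon_Nikodym_SigmaFinite.change_of_variables
  (normal_prob_dominates m s))//.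
have mRN := Radon_Nikodym_SigmaFinite.f_integrable (normal_prob_dominates m s).
apply: ae_eq_integral => //.
- by apply: emeasurable_funM => //; exact: measurable_int mRN.
- apply: emeasurable_funM => //; apply/measurable_EFinP.
  exact: measurable_normal_pdf.
- apply: ae_eqe_mul2l; apply: integral_ae_eq => //.
  + by apply/measurable_EFinP; exact: measurable_normal_pdf.
  + by move=> A _ mA; rewrite -Radon_Nikodym_SigmaFinite.f_integral//;
      exact: normal_prob_dominates.
Qed.

(** Squeeze between 0 and [2 s^2 / x], by [1 + u <= exp u] at [u = x^2 / (2 s^2)]. This kills the
    boundary term at infinity in the integration by parts for the second moment. *)
Lemma cvg_x_normal_fun (s : R) : s != 0%R ->
  (x * normal_fun 0 s x)%R @[x --> +oo%R] --> (0 : R)%R.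
Proof.
move=> s0.
have s2 : (0 < s ^+ 2)%R by rewrite exprn_even_gt0.
have : ((2 * s ^+ 2) * x^-1)%R @[x --> +oo%R] --> (0 : R)%R.
  rewrite -[X in _ --> X](mulr0 (2 * s ^+ 2)%R).
  apply: cvgM; first exact: cvg_cst.
  by apply/gtr0_cvgV0; [near=> x; near: x; exact: nbhs_pinfty_gt|exact: cvg_id].
apply: squeeze_cvgr (cvg_cst 0%R).
near=> x.
have x0 : (0 < x)%R by near: x; exact: nbhs_pinfty_gt.
rewrite mulr_ge0 ?normal_fun_ge0 ?ltW//=.
rewrite /normal_fun subr0 mulNr expRN.
rewrite ltr_pdivrMr ?expR_gt0//.
have := expR_ge1Dx (x ^+ 2 / (s ^+ 2 *+ 2)).
rewrite -(ler_pM2l (x := (2 * s ^+ 2) * x^-1)%R); last first.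
  by rewrite mulr_gt0 ?invr_gt0// mulr_gt0.
apply: lt_le_trans.
have -> : (2 * s ^+ 2 / x * (1 + x ^+ 2 / (s ^+ 2 *+ 2)) =
    2 * s ^+ 2 * x^-1 + x)%R.
  by rewrite -mulr_natl; field; rewrite s0 gt_eqF.
by rewrite ltrDr mulr_gt0 ?invr_gt0// mulr_gt0.
Unshelve. all: by end_near. Qed.

Lemma is_derive_normal_pdf0 (s x : R) : s != 0%R ->
  is_derive x (1 : R)%R (normal_pdf 0 s : R -> R)
    (- (x / s ^+ 2) * normal_pdf 0 s x)%R.
Proof.
move=> s0; rewrite normal_pdfE//.
have -> : (fun x => normal_peak s * normal_fun 0 s x)%R =
    (normal_peak s \*: (expR \o ((- (s ^+ 2 *+ 2)^-1)%R \*: (id ^+ 2)%R)))%R.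
  apply/funext => y; rewrite /normal_fun /= /GRing.scale/= subr0.
  by congr (_ * expR _)%R; rewrite !fctE mulNr mulrC mulNr.
apply: is_derive_eq.
rewrite /normal_fun /GRing.scale/= !fctE subr0 expr1 mulr1.
have -> : (- (s ^+ 2 *+ 2)^-1 *: x ^+ 2 = - x ^+ 2 / (s ^+ 2 *+ 2))%R.
  by rewrite /GRing.scale/= !mulNr mulrC.
by move: (expR _) => e; rewrite -mulr_natl; field.
Qed.

Lemma integral_sqr_normal_pdf0 (s : R) : s != 0%R ->
  \int[mu]_x (x ^+ 2 * normal_pdf 0 s x)%:E = (s ^+ 2)%:E.
Proof.
move=> s0; pose G : R -> R := normal_pdf 0 s.
have cG : continuous G by exact: continuous_normal_pdf.
have G_ge0 x : (0 <= G x)%R by exact: normal_pdf_ge0.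
have iG : mu.-integrable setT (EFin \o G) by exact: integrable_normal_pdf.
have evenG x : G (- x)%R = G x.
  by rewrite /G -sub0r normal_pdf_reflect// subr0.
(* [H] is the cumulative distribution function of [normal_prob 0 s]: its derivative is [G], and it
   tends to 1 at infinity. *)
pose H (x : R) := (\int[mu]_(t in [set` `]-oo, x]]) G t)%R.
have dH x : is_derive x (1 : R)%R H (G x).
  (* The endpoint [x + 1] only serves to leave room to the right of [x]. *)
  have [] := @continuous_FTC1 R G -oo%O x (x + 1)%R _ _ _ (cG x).
  - by rewrite ltrDl.
  - exact: integrableS iG.
  - by rewrite ltNyr.
  by move=> dHx HE; apply: (DeriveDef dHx); rewrite -derive1E.
have Hy : H x @[x --> +oo%R] --> (1 : R)%R.
  pose idR := HB.pack_for {mfun measurableTypeR R >-> R}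
    (idfun : measurableTypeR R -> R)
    (isMeasurableFun.Build _ _ _ _ (idfun : measurableTypeR R -> R)
      (@measurable_id _ _ setT)).
  have := @cvg_cdfy1 _ _ R (normal_prob 0 s) idR.
  rewrite (_ : @cdf _ _ _ _ _ = EFin \o H); last first.
    apply/funext => r; rewrite /cdf /distribution/= /pushforward preimage_id.
    rewrite /H /Rintegral fineK//.
    apply: integrable_fin_num => //=.
    exact: integrableS iG.
  by move/fine_cvgP => [].
(* As [G' x = - x / s^2 * G x], this is an antiderivative of [x^2 G x]. *)
pose F (x : R) := (s ^+ 2 * (H x - x * G x))%R.
have dF x : is_derive x (1 : R)%R F (x ^+ 2 * G x)%R.
  have dG := is_derive_normal_pdf0 s x s0.
  have -> : F = (s ^+ 2 \*: (H - id * G))%R by [].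
  apply: is_derive_eq; rewrite /GRing.scale/=.
  by rewrite /G; field.
have Fy : F x @[x --> +oo%R] --> (s ^+ 2 * (1 - 0))%R.
  apply: cvgM; first exact: cvg_cst.
  apply: cvgB => //.
  have -> : (fun x => x * G x)%R =
      (fun x => normal_peak s * (x * normal_fun 0 s x))%R.
    by apply/funext => x; rewrite /G normal_pdfE// mulrCA.
  rewrite -[X in _ --> X](mulr0 (normal_peak s)).
  apply: cvgM; [exact: cvg_cst|exact: cvg_x_normal_fun].
have cvg0 (f df : R -> R) : (forall x, is_derive x (1 : R)%R f (df x)) ->
    f x @[x --> 0%R^'+] --> f 0%R.
  move=> df0; apply: cvg_at_right_filter.
  have [d _] := df0 0%R.
  exact/differentiable_continuous/derivable1_diffP.
have evenint (f : R -> R) : (forall x, 0 <= f x)%R -> continuous f ->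
    (forall x, f (- x) = f x)%R ->
    \int[mu]_x (f x)%:E = 2%:E * \int[mu]_(x in `[0%R, +oo[) (f x)%:E.
  move=> f0 cf ef; rewrite set_itvcy; apply: ge0_symfun_integralT => // x.
  by rewrite /= ef.
have FTC (f K : R -> R) (l : R) : (forall x, 0 <= f x)%R -> continuous f ->
    K x @[x --> +oo%R] --> l ->
    (forall x, is_derive x (1 : R)%R K (f x)) ->
    \int[mu]_(x in `[0%R, +oo[) (f x)%:E = l%:E - (K 0%R)%:E.
  move=> f0 cf Kl dK; apply: ge0_continuous_FTC2y => //.
  - exact: continuous_subspaceT.
  - exact: cvg0 dK.
  - by move=> x _; rewrite derive1E; have [] := dK x.
have halfG := FTC _ _ _ G_ge0 cG Hy dH.
have c2 : continuous (fun x : R => x ^+ 2 * G x)%R.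
  by move=> x; apply: cvgM; [exact: sqr_continuous|exact: cG].
have x2G_ge0 x : (0 <= x ^+ 2 * G x)%R by rewrite mulr_ge0// sqr_ge0.
rewrite -[normal_pdf 0 s]/G evenint//; last by move=> x; rewrite sqrrN evenG.
rewrite (FTC _ _ _ x2G_ge0 c2 Fy dF).
(* The half-line integral of [x^2 G] is [s^2 (1 - H 0)]. Total mass 1 and evenness of [G] give
   [2 (1 - H 0) = 1], so [H 0] need not be computed. *)
have := integral_normal_pdf 0 s; rewrite evenint// halfG -EFinB -EFinM => -[HE].
rewrite -EFinB -EFinM /F mul0r !subr0 mulr1; congr EFin.
transitivity (s ^+ 2 * (2 * (1 - H 0)))%R; [by ring|by rewrite HE mulr1].
Qed.

End normal_moments.

(** Domination: [|x| <= 1 + x^2], and constants are integrable for a probability. *)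
Lemma integrable_of_sqr {d : measure_display} {T : measurableType d}
    {R : realType} (P : probability T R) (X : T -> R) :
  measurable_fun setT X -> (\int[P]_w (X w ^+ 2)%:E < +oo)%E ->
  P.-integrable setT (EFin \o X).
Proof.
move=> mX X2.
have mX2 : measurable_fun setT (fun w => X w ^+ 2) by exact: measurable_funX.
have iX2 : P.-integrable setT (fun w => (X w ^+ 2)%:E).
  apply/integrableP; split; first exact/measurable_EFinP.
  by under eq_integral do rewrite gee0_abs ?lee_fin ?sqr_ge0//.
apply: (@le_integrable _ _ _ _ _ _ _ (fun w => (1 + X w ^+ 2)%:E)) => //.
- exact/measurable_EFinP.
- move=> w _; rewrite lee_fin [leRHS]ger0_norm ?addr_ge0 ?sqr_ge0//.
  rewrite -(real_normK (num_real (X w))); have := normr_ge0 (X w).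
  by move: `|X w| => y y0; nra.
- under eq_fun do rewrite EFinD.
  by apply: integrableD => //; exact: finite_measure_integrable_cst.
Qed.

(** * Mean and variance of [gaussian m v], including the degenerate case *)

Section gaussian_moments.
Context {R : realType}.
Local Open Scope ereal_scope.

(** The substitution [x |-> m - x] turns the density centered at [m] into the one centered at 0. *)
Lemma integral_sqr_normal_prob (m s : R) : s != 0%R ->
  \int[normal_prob m s]_x ((x - m) ^+ 2)%:E = (s ^+ 2)%:E.
Proof.
move=> s0.
have msq : measurable_fun setT (fun x : R => ((x - m) ^+ 2)%:E).
  by apply/measurable_EFinP/measurable_funX; exact: measurable_funB.
rewrite ge0_integral_normal_prob//; last by move=> x; rewrite lee_fin sqr_ge0.
rewrite -(ge0_integral_reflect m); first last.
- by move=> x; rewrite -EFinM lee_fin mulr_ge0 ?sqr_ge0 ?normal_pdf_ge0.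
- apply: emeasurable_funM => //; apply/measurable_EFinP.
  exact: measurable_normal_pdf.
rewrite -(integral_sqr_normal_pdf0 s s0); apply: eq_integral => x _.
rewrite -EFinM normal_pdf_reflect// subrr; congr (_ * _)%:E.
by ring.
Qed.

(* The positive and negative parts of [x - m] are exchanged by the reflection
   [x |-> 2 m - x], which preserves the normal density. *)
Lemma integral_center_normal_prob (m s : R) : s != 0%R ->
  \int[normal_prob m s]_x (x - m)%:E = 0.
Proof.
move=> s0; pose f (x : R) := (x - m)%:E.
have mB : measurable_fun setT (fun x : R => x - m)%R by exact: measurable_funB.
have mf : measurable_fun setT f by exact/measurable_EFinP.
have intf : (normal_prob m s).-integrable setT f.
  by apply: integrable_of_sqr => //; rewrite integral_sqr_normal_prob// ltry.
rewrite integralE.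
suff -> : \int[normal_prob m s]_x f^\- x = \int[normal_prob m s]_x f^\+ x.
  by rewrite subee// integrable_fin_num//; exact: integrable_funepos.
rewrite !ge0_integral_normal_prob//; last 2 first.
- exact: measurable_funepos.
- exact: measurable_funeneg.
rewrite -(ge0_integral_reflect (2 * m)); first last.
- by move=> x; rewrite mule_ge0// lee_fin normal_pdf_ge0.
- apply: emeasurable_funM; first exact: measurable_funeneg.
  by apply/measurable_EFinP; exact: measurable_normal_pdf.
apply: eq_integral => x _; rewrite normal_pdf_reflect//.
have -> : (2 * m - m = m)%R by ring.
by rewrite funenegE funeposE /f -EFinN; congr (maxe _ _ * _); congr EFin; ring.
Qed.

(** Since [gaussian m v] is a bare set function, integrals are taken against a probability [Q]
    agreeing with it on measurable sets. The Dirac case matters: both noise variances of the scheme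
    may vanish. *)
Lemma gaussian_moments (Q : probability (measurableTypeR R) R) (m v : R) :
  (0 <= v)%R -> (forall A : set R, measurable A -> Q A = gaussian m v A) ->
  \int[Q]_x ((x - m) ^+ 2)%:E = v%:E /\ \int[Q]_x (x - m)%:E = 0.
Proof.
rewrite /gaussian; case: eqVneq => [->|v0] v_ge0 QE.
  have msq : measurable_fun setT (fun x : R => (x - m)%:E).
    by apply/measurable_EFinP; exact: measurable_funB.
  have QI f : \int[Q]_x f x =
      \int[@dirac _ (measurableTypeR R) m R]_x f x.
    by apply: eq_measure_integral => A mA _; exact: QE.
  split; rewrite QI.
  - rewrite integral_dirac//; last by apply/measurable_EFinP/measurable_funX/measurable_EFinP.
    by rewrite diracT mul1e subrr expr0n.
  - by rewrite integral_dirac// diracT mul1e subrr.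
have s0 : Num.sqrt v != 0%R by rewrite gt_eqF// sqrtr_gt0 lt_neqAle eq_sym v0.
have QI f : \int[Q]_x f x = \int[normal_prob m (Num.sqrt v)]_x f x.
  by apply: eq_measure_integral => A mA _; exact: QE.
split; rewrite QI.
- by rewrite integral_sqr_normal_prob// sqr_sqrtr.
- exact: integral_center_normal_prob.
Qed.

End gaussian_moments.

(** * Independent centered variables are uncorrelated; second moment of a linear combination *)

Section independence.
Context {d : measure_display} {T : measurableType d} {R : realType}.
Variable P : probability T R.
Local Open Scope ereal_scope.

(** Domination: [|x y| <= x^2 + y^2]. *)
Lemma integrable_prod_of_sqr (X Y : T -> R) :
  measurable_fun setT X -> measurable_fun setT Y ->
  \int[P]_w (X w ^+ 2)%:E < +oo -> \int[P]_w (Y w ^+ 2)%:E < +oo ->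
  P.-integrable setT (fun w => (X w * Y w)%:E).
Proof.
move=> mX mY X2 Y2.
have isq (Z : T -> R) : measurable_fun setT Z ->
    \int[P]_w (Z w ^+ 2)%:E < +oo -> P.-integrable setT (fun w => (Z w ^+ 2)%:E).
  move=> mZ Z2; apply/integrableP; split.
    by apply/measurable_EFinP; exact: measurable_funX.
  by under eq_integral do rewrite gee0_abs ?lee_fin ?sqr_ge0//.
apply: (@le_integrable _ _ _ _ _ _ _ (fun w => (X w ^+ 2 + Y w ^+ 2)%:E)) => //.
- by apply/measurable_EFinP; exact: measurable_funM.
- move=> w _; rewrite lee_fin [leRHS]ger0_norm ?addr_ge0 ?sqr_ge0//.
  rewrite ler_norml; apply/andP; split; nra.
- under eq_fun do rewrite EFinD.
  by apply: integrableD => //; exact: isq.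
Qed.

(** The factorization on rectangles identifies the law of [(X, Y)] with the product of the
    marginals. By Fubini, integrating [x y] first in [x] gives [y] times the mean of [X], which is
    0. *)
Lemma independent_centered_uncorrelated (X Y : {RV P >-> R}) :
  (forall A B : set R, measurable A -> measurable B ->
    P (X @^-1` A `&` Y @^-1` B) = P (X @^-1` A) * P (Y @^-1` B)) ->
  \int[P]_w (X w ^+ 2)%:E < +oo -> \int[P]_w (Y w ^+ 2)%:E < +oo ->
  \int[P]_w (X w)%:E = 0 ->
  \int[P]_w (X w * Y w)%:E = 0.
Proof.
move=> indep X2 Y2 X0.
have mX : measurable_fun setT X by exact: measurable_funP.
have mY : measurable_fun setT Y by exact: measurable_funP.
have iXY := integrable_prod_of_sqr _ _ mX mY X2 Y2.
pose phi w := (X w, Y w).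
have mphi : measurable_fun setT phi by exact: measurable_fun_pair.
pose f (z : R * R) := (z.1 * z.2)%:E.
have mf : measurable_fun setT f.
  by apply/measurable_EFinP; exact: measurable_funM.
have prodE A : measurable A ->
    pushforward P phi A = (distribution P X \x distribution P Y) A.
  move=> mA; apply/esym.
  pose Q : {measure set (R * R) -> \bar R} :=
    distribution P (HB.pack_for {mfun T >-> (R * R)%type} phi
      (isMeasurableFun.Build _ _ _ _ phi mphi)).
  by apply: (@product_measure_unique _ _ _ _ _ _ _ Q).
have prodI g : \int[pushforward P phi]_z g z =
    \int[distribution P X \x distribution P Y]_z g z.
  by apply: eq_measure_integral => // A mA _; exact: prodE.
(* Fubini for a signed integrand requires integrability under the product law; it is carried over
   from [P] through the pushforward. *)
have iprod : (distribution P X \x distribution P Y).-integrable setT f.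
  have /integrableP[_] := integrable_pushforward mphi mf iXY measurableT.
  by rewrite prodI => ?; apply/integrableP.
have -> : \int[P]_w (X w * Y w)%:E = \int[pushforward P phi]_z f z.
  by rewrite integral_pushforward.
rewrite prodI -integral21_prod_meas1//.
apply: integral0_eq => y _; rewrite /fubini_G /f/=.
under eq_integral do rewrite EFinM.
have iX := integrable_of_sqr _ _ mX X2.
rewrite integralZr//; last first.
  by apply: integrable_pushforward => //; exact: measurable_funP.
by rewrite integral_distribution//= X0 mul0e.
Qed.

(** The square expands into a double sum of which only the diagonal survives integration. *)
Lemma integral_sqr_sum_uncorrelated (I : finType) (X : I -> T -> R)
    (v c : I -> R) :
  (forall i j, P.-integrable setT (fun w => (X i w * X j w)%:E)) ->
  (forall i, \int[P]_w (X i w ^+ 2)%:E = (v i)%:E) ->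
  (forall i j, i != j -> \int[P]_w (X i w * X j w)%:E = 0) ->
  \int[P]_w ((\sum_i c i * X i w) ^+ 2)%:E = (\sum_i c i ^+ 2 * v i)%:E.
Proof.
move=> iX vX uX.
transitivity (\int[P]_w
    (\sum_i \sum_j (c i * c j)%:E * (X i w * X j w)%:E)).
  apply: eq_integral => w _; rewrite expr2 mulr_suml -sumEFin.
  apply: eq_bigr => i _; rewrite mulr_sumr -sumEFin; apply: eq_bigr => j _.
  by rewrite -EFinM mulrACA.
rewrite integral_sum//; last first.
  by move=> i; apply: integrable_sum => // j _; exact: integrableZl.
rewrite -sumEFin; apply: eq_bigr => i _.
rewrite integral_sum//; last by move=> j; exact: integrableZl.
rewrite (bigD1 i)//= big1 ?adde0; last first.
  by move=> j ji; rewrite integralZl// uX 1?eq_sym// mule0.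
by rewrite integralZl//= [RHS]EFinM -vX expr2.
Qed.

End independence.

(** * Indexing of the sources, their coordinate laws and pairwise independence *)

Lemma big_option {V : nmodType} {I : finType} (F : option I -> V) :
  \sum_j F j = F None + \sum_i F (Some i).
Proof.
by rewrite ![index_enum _]unlock [@Finite.enum in LHS]unlock/= big_cons big_map.
Qed.

Lemma gaussian_setT {R : realType} (m v : R) : gaussian m v setT = 1%E.
Proof. by rewrite /gaussian; case: ifP => _; rewrite ?diracT ?probability_setT. Qed.

(** Evaluate the law on the rectangle with side [A] in direction [k] and the whole line elsewhere;
    the other factors are 1. *)
Lemma has_gaussian_law_coord {R : realType} {d : nat} {disp : measure_display}
    {Omega : measurableType disp} (Q : probability Omega R)
    (V : {RV Q >-> d.-tuple R}) (m : 'rV[R]_d) (v : R) (k : 'I_d) (A : set R) :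
  has_gaussian_law V m v -> measurable A ->
  Q ((fun w => tnth (V w) k) @^-1` A) = gaussian (m 0 k) v A.
Proof.
move=> /(_ (fun j => if j == k then A else setT)) lawV mA.
have := lawV _; rewrite (bigD1 k)//= eqxx big1 ?mule1; last first.
  by move=> j /negbTE ->; exact: gaussian_setT.
move=> <-; last by move=> j; case: ifP.
rewrite /distribution/= /pushforward; congr (Q _).
apply/seteqP; split => w /=.
  by move=> Aw j; case: eqVneq => [->|].
by move=> /(_ k); rewrite eqxx.
Qed.

Lemma gaussian_law_moments {R : realType} {d : nat} {disp : measure_display}
    {Omega : measurableType disp} (Q : probability Omega R)
    (V : {RV Q >-> d.-tuple R}) (m : 'rV[R]_d) (v : R) (k : 'I_d) : 0 <= v ->
  has_gaussian_law V m v ->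
  (\int[Q]_w ((tnth (V w) k - m ord0 k) ^+ 2)%:E = v%:E)%E /\
  (\int[Q]_w (tnth (V w) k - m ord0 k)%:E = 0)%E.
Proof.
move=> v0 lawV.
have mVk : measurable_fun setT (fun w => tnth (V w) k).
  apply: (measurableT_comp (f := fun x : d.-tuple R => tnth x k)) => //.
  exact: measurable_tnth.
pose X := HB.pack_for {mfun Omega >-> measurableTypeR R}
  ((fun w => tnth (V w) k) : Omega -> measurableTypeR R)
  (isMeasurableFun.Build _ _ _ _
    ((fun w => tnth (V w) k) : Omega -> measurableTypeR R) mVk).
have [E2 E1] := gaussian_moments (distribution Q X) (m ord0 k) v v0
  (fun A mA => has_gaussian_law_coord Q V m v k A lawV mA).
have mc : measurable_fun setT (fun x : R => x - m ord0 k).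
  exact: measurable_funB.
(* The second moment comes first: nonnegativity suffices to transfer it, and its finiteness gives
   the integrability that the mean requires. *)
have E2' : (\int[Q]_w ((tnth (V w) k - m ord0 k) ^+ 2)%:E = v%:E)%E.
  rewrite -E2 ge0_integral_distribution//.
  - by apply/measurable_EFinP; exact: measurable_funX.
  - by move=> y; rewrite lee_fin sqr_ge0.
split => //.
rewrite -E1 integral_distribution//.
  by apply/measurable_EFinP.
apply: (integrable_of_sqr Q (fun w => tnth (V w) k - m ord0 k)).
- exact: measurable_funB.
- by rewrite E2' ltry.
Qed.

(** Mutual independence is used for the index set [{i, j}]. *)
Lemma mutually_independent_pair {R : realType} {disp disp' : measure_display}
    {Omega : measurableType disp} {T : measurableType disp'}
    (Q : probability Omega R) (I : finType) (V : I -> {RV Q >-> T}) (i j : I)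
    (A B : set T) :
  i != j -> mutually_independent V -> measurable A -> measurable B ->
  Q (V i @^-1` A `&` V j @^-1` B) = (Q (V i @^-1` A) * Q (V j @^-1` B))%E.
Proof.
move=> ij indep mA mB; pose C l := if l == i then A else B.
have ji : (j == i) = false by rewrite eq_sym (negbTE ij).
have := indep [set i; j]%SET C.
rewrite big_setU1/= ?inE// big_set1 /C eqxx ji => <-; last first.
  by move=> l; case: ifP.
congr (Q _); apply/seteqP; split => w /=.
  by move=> [Aw Bw] l; rewrite /= !inE => /orP[] /eqP ->; rewrite ?eqxx ?ji.
move=> h; split; [have := h i|have := h j]; rewrite /= !inE eqxx ?ji ?orbT.
  by apply.
by apply.
Qed.

(** * Mean square error of the robust scheme *)

Section scheme_error.
Context {R : realType} {n d : nat} (sigma B P sigma0 eps : R).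
Context {disp : measure_display} {Omega : measurableType disp}.
Context (Pr : 'rV[R]_d -> probability Omega R).
Context (U Zpri : 'I_n -> {mfun Omega >-> d.-tuple R}).
Context (Z : {mfun Omega >-> d.-tuple R}).
Hypotheses (n_gt0 : (0 < n)%N) (sigma_gt0 : 0 < sigma) (P_gt0 : 0 < P).
Hypotheses (eps_gt0 : 0 < eps).
Hypothesis noise_le : 2 * eps * sigma0 ^+ 2 <= d%:R * P.

Let q := sigma_pri2 n d P sigma0 eps.
Let P' := power_left n d P sigma0 eps.
Let S := all_sources U Zpri Z.

Definition source_mean (theta : 'rV[R]_d) (j : option ('I_n + 'I_n)) :=
  if j is Some (inl _) then theta else 0.

Definition source_var (j : option ('I_n + 'I_n)) :=
  match j with
  | Some (inl _) => sigma ^+ 2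
  | Some (inr _) => sigma_pri2 n d P sigma0 eps
  | None => sigma0 ^+ 2
  end.

(** Data are weighted by [1/n] because the amplification by the user cancels against the rescaling
    by the processor; the noises undergo only the rescaling. *)
Definition source_gain (j : option ('I_n + 'I_n)) :=
  if j is Some (inl _) then n%:R^-1
  else n%:R^-1 *
    Num.sqrt ((B ^+ 2 + sigma ^+ 2) / power_left n d P sigma0 eps).

Let den_gt0 : 0 < 2 * eps * n%:R + d%:R :> R.
Proof. by rewrite ltr_pwDl ?ler0n// !mulr_gt0// ltr0n. Qed.

(** By [noise_le] the first argument of the maximum is nonnegative. *)
Let qE : q = (d%:R * P - 2 * eps * sigma0 ^+ 2) / (2 * eps * n%:R + d%:R).
Proof.
rewrite /q /sigma_pri2; apply/max_idPl.
by rewrite divr_ge0 ?subr_ge0// ltW.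
Qed.

Let P'E : P' = 2 * eps * (n%:R * P + sigma0 ^+ 2) / (2 * eps * n%:R + d%:R).
Proof. by rewrite /P' /power_left -/q qE; field; rewrite gt_eqF. Qed.

Let nP_gt0 : 0 < n%:R * P + sigma0 ^+ 2.
Proof. by rewrite ltr_pwDl ?sqr_ge0// mulr_gt0// ltr0n. Qed.

(** Keeps the square roots and quotients of the scheme away from their default values. *)
Let P'_gt0 : 0 < P'.
Proof. by rewrite P'E divr_gt0// !mulr_gt0. Qed.

Let Bs_gt0 : 0 < B ^+ 2 + sigma ^+ 2.
Proof. by rewrite ltr_wpDl ?sqr_ge0// exprn_gt0. Qed.

Lemma estimation_errorE (theta : 'rV[R]_d) (w : Omega) :
  sqnorm2 (estimator n sigma B P sigma0 eps
    (received sigma B P sigma0 eps U Zpri Z w) - theta) =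
  \sum_k (\sum_j source_gain j * (tnth (S j w) k - source_mean theta j 0 k)) ^+ 2.
Proof.
apply: eq_bigr => k _; congr (_ ^+ 2).
rewrite big_option big_sumType/= /source_gain/=.
rewrite /estimator /received !mxE summxE.
under [X in _ * (X + _) - _]eq_bigr do rewrite /sent !mxE.
rewrite big_split/= -mulr_sumr -/P' subr0.
under [X in _ = _ + (_ + X)]eq_bigr do rewrite subr0.
(* The coordinate of [theta] appears as [n] copies weighted by [1/n], one per user. *)
rewrite -[in RHS]mulr_sumr -[in RHS]mulr_sumr sumrB sumr_const card_ord.
rewrite -[in RHS]mulr_natl.
have -> : Num.sqrt ((B ^+ 2 + sigma ^+ 2) / P') =
    (Num.sqrt (P' / (B ^+ 2 + sigma ^+ 2)))^-1.
  by rewrite -sqrtrV ?invf_div// divr_ge0// ltW.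
have : Num.sqrt (P' / (B ^+ 2 + sigma ^+ 2)) != 0.
  by rewrite gt_eqF// sqrtr_gt0 divr_gt0.
have : n%:R != 0 :> R by rewrite pnatr_eq0 -lt0n.
by move=> ? ?; field; apply/andP.
Qed.

Lemma sum_source_gain_var :
  \sum_j source_gain j ^+ 2 * source_var j =
  sigma ^+ 2 / n%:R *
    (1 + d%:R / (2 * n%:R * eps) * (1 + B ^+ 2 / sigma ^+ 2)).
Proof.
have sum_cst (x : R) : \sum_(i < n) x = n%:R * x.
  by rewrite sumr_const card_ord mulr_natl.
rewrite big_option big_sumType/= /source_gain/= -/q -/P' !sum_cst.
rewrite exprMn sqr_sqrtr; last by rewrite divr_ge0 ?ltW.
(* Here [n q + sigma0^2 = d (n P + sigma0^2) / (2 eps n + d)], which is [d / (2 eps)] times [P']. *)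
rewrite P'E qE; field.
by rewrite !gt_eqF// ltr0n.
Qed.

Hypothesis model : robust_model sigma B P sigma0 eps Pr U Zpri Z.

Lemma expected_error (theta : 'rV[R]_d) : Theta B theta ->
  'E_(Pr theta)[fun w => sqnorm2 (estimator n sigma B P sigma0 eps
      (received sigma B P sigma0 eps U Zpri Z w) - theta)]%E =
  (d%:R * sigma ^+ 2 / n%:R *
    (1 + d%:R / (2 * n%:R * eps) * (1 + B ^+ 2 / sigma ^+ 2)))%:E.
Proof.
move=> /model [lawU lawZpri lawZ indep].
have law j : has_gaussian_law (Q := Pr theta) (S j) (source_mean theta j) (source_var j).
  by case: j => [[i|i]|] /=; [exact: lawU|exact: lawZpri|exact: lawZ].
have var_ge0 j : 0 <= source_var j.
  case: j => [[i|i]|] /=; rewrite ?sqr_ge0//.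
  by rewrite /sigma_pri2 le_max lexx orbT.
have mX j k : measurable_fun setT
    (fun x : d.-tuple R => tnth x k - source_mean theta j 0 k).
  by apply: measurable_funB => //; exact: measurable_tnth.
have mXS j k : measurable_fun setT
    (fun w => tnth (S j w) k - source_mean theta j 0 k).
  exact: (measurableT_comp (mX j k)).
pose X k j := HB.pack_for {mfun Omega >-> R}
  (fun w => tnth (S j w) k - source_mean theta j 0 k)
  (isMeasurableFun.Build _ _ _ _
    (fun w => tnth (S j w) k - source_mean theta j 0 k) (mXS j k)).
have X2 k j : (\int[Pr theta]_w (X k j w ^+ 2)%:E = (source_var j)%:E)%E.
  by have [] := gaussian_law_moments _ _ _ _ k (var_ge0 j) (law j).
have X1 k j : (\int[Pr theta]_w (X k j w)%:E = 0)%E.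
  by have [] := gaussian_law_moments _ _ _ _ k (var_ge0 j) (law j).
have uncorr k i j : i != j -> (\int[Pr theta]_w (X k i w * X k j w)%:E = 0)%E.
  move=> ij; apply: independent_centered_uncorrelated; rewrite ?X2 ?X1 ?ltry//.
  move=> C D mC mD.
  (* An event on coordinate [k] is an event on the whole vector, so independence of the vectors
     passes to their coordinates. *)
  apply: (mutually_independent_pair _ _ _ _ _
    ((fun x => tnth x k - source_mean theta i 0 k) @^-1` C)
    ((fun x => tnth x k - source_mean theta j 0 k) @^-1` D) ij indep).
  - by rewrite -[_ @^-1` _]setTI; exact: mX.
  - by rewrite -[_ @^-1` _]setTI; exact: mX.
rewrite unlock.
under eq_integral do rewrite estimation_errorE -sumEFin.
rewrite ge0_integral_sum//; first last.
- by move=> k w _; rewrite lee_fin sqr_ge0.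
- move=> k; apply/measurable_EFinP/measurable_funX; apply: measurable_sum => j.
  exact: measurable_funM.
transitivity (\sum_(k < d)
    (\sum_j source_gain j ^+ 2 * source_var j)%:E)%E.
  apply: eq_bigr => k _.
  apply: (integral_sqr_sum_uncorrelated _ _ (fun j => X k j : Omega -> R)) => //.
    by move=> i j; apply: integrable_prod_of_sqr; rewrite ?X2 ?ltry.
  exact: uncorr.
rewrite sumEFin sumr_const card_ord sum_source_gain_var; congr EFin.
by rewrite -[LHS]mulr_natl !mulrA.
Qed.

End scheme_error.

Theorem corollary1 (R : realType) (n d : nat) (sigma B P sigma0 eps : R)
    (disp : measure_display) (Omega : measurableType disp)
    (Pr : 'rV[R]_d -> probability Omega R)
    (U Zpri : 'I_n -> {mfun Omega >-> d.-tuple R})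
    (Z : {mfun Omega >-> d.-tuple R})
    (n_gt0 : (0 < n)%N) (d_gt0 : (0 < d)%N)
    (sigma_gt0 : 0 < sigma) (B_gt0 : 0 < B) (P_gt0 : 0 < P)
    (sigma0_ge0 : 0 <= sigma0) (eps_gt0 : 0 < eps)
    (noise_le : 2 * eps * sigma0 ^+ 2 <= d%:R * P)
    (model : robust_model sigma B P sigma0 eps Pr U Zpri Z) :
  R_robust sigma B P sigma0 eps Pr U Zpri Z =
  (d%:R * sigma ^+ 2 / n%:R *
    (1 + d%:R / (2 * n%:R * eps) * (1 + B ^+ 2 / sigma ^+ 2)))%:E.
Proof.
(* The error is constant on [Theta B], so the supremum is over a singleton once [Theta B] is known
   to be nonempty; over the empty set it would be [-oo]. *)
have Theta0 : Theta B (0 : 'rV[R]_d).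
  rewrite /Theta/= /norm2 /sqnorm2 big1 ?sqrtr0 ?mulr_ge0 ?sqrtr_ge0 ?ltW//.
  by move=> k _; rewrite mxE expr0n.
rewrite /R_robust -[RHS]ereal_sup1; congr ereal_sup; apply/seteqP; split => x /=.
  by move=> [theta Ttheta <-]; exact: expected_error.
by move=> ->; exists 0 => //; exact: expected_error.
Qed.
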